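(* Let $I=\{m_1,\ldots,m_k\}$ be a finite set of unary function symbols, let $\mathbf{A}$ be an I-modal ririg and let $X\subseteq A$. Then the least I-filter $\mathsf{Fg}^{\mathbf{A}}(X)$ of $\mathbf{A}$ containing $X$ is $$\mathsf{Fg}^{\mathbf{A}}(X)=\ \uparrow\Big\{\prod_{i=1}^{n}\lambda^{l}(x_{i})\colon x_{1},\ldots,x_{n}\in X\ \text{and}\ l\in\mathbb{N}\Big\}.$$
   Context: A ririg is an algebra $(A,\vee,\cdot,\to,0,1)$ such that $(A,\vee,0)$ and $(A,\cdot,1)$ are commutative monoids, $x\cdot 0=0$, $x\cdot(y\vee z)=(x\cdot y)\vee(x\cdot z)$ and $1\vee x=1$ for all $x,y,z$ (order: $x\leq y$ iff $x\vee y=y$), and $a\cdot b\leq c$ iff $a\leq b\to c$. A modal operator on a ririg is a unary operation $m$ with $m(1)=1$ and $m(x\to y)\leq m(x)\to m(y)$. An I-modal ririg is a ririg with a modal operator $m$ for each $m\in I$. An I-filter of $\mathbf{A}$ is a non-empty up-set $F\subseteq A$ closed under $\cdot$ and under each $m\in I$. The operation $\lambda$ is $\lambda(x)=x\cdot\prod_{j=1}^{k}m_j(x)$, with $\lambda^0(x)=x$, $\lambda^{l+1}(x)=\lambda(\lambda^l(x))$; $\mathbb{N}$ includes $0$. $\uparrow Y=\{z\in A: y\leq z\text{ for some }y\in Y\}$. In the description, $n$ ranges over natural numbers, the $x_i$ need not be distinct, and $n=0$ gives the empty product $1$. *)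

(* Defs.v *)
From HB Require Import structures.
From mathcomp Require Import all_boot.
From mathcomp Require Import classical_sets.

Set Implicit Arguments.
Unset Strict Implicit.
Unset Printing Implicit Defensive.

Local Open Scope classical_set_scope.

(* The equations [_ = c] and [_ = rimp b c] in [rmul_residuated] spell out the
   order [rle] defined below. The equation 0 = 1 is not excluded. *)
HB.mixin Record isRirig (A : Type) := {
  rjoin : A -> A -> A;
  rmul : A -> A -> A;
  rimp : A -> A -> A;
  rzero : A;
  rone : A;
  rjoinA : associative rjoin;
  rjoinC : commutative rjoin;
  rjoin0l : left_id rzero rjoin;
  rmulA : associative rmul;
  rmulC : commutative rmul;
  rmul1l : left_id rone rmul;
  rmul0r : right_zero rzero rmul;
  rmul_joinr : right_distributive rmul rjoin;
  rjoin1l : left_zero rone rjoin;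
  rmul_residuated : forall a b c : A,
    rjoin (rmul a b) c = c <-> rjoin a (rimp b c) = rimp b c
}.

#[short(type="ririgType")]
HB.structure Definition Ririg := { A of isRirig A }.

HB.instance Definition _ (A : ririgType) :=
  Monoid.isComLaw.Build A rzero rjoin rjoinA rjoinC rjoin0l.
HB.instance Definition _ (A : ririgType) :=
  Monoid.isComLaw.Build A rone rmul rmulA rmulC rmul1l.

Definition rle (A : ririgType) (x y : A) : Prop := rjoin x y = y.

(* Elements of [I] are symbols: distinct ones may have the same
   interpretation. *)
HB.mixin Record hasModalOperators (I : Type) A of Ririg A := {
  modal : I -> A -> A;
  modal1 : forall m : I, modal m rone = rone;
  modal_imp : forall (m : I) (x y : A),
    rle (modal m (rimp x y)) (rimp (modal m x) (modal m y))
}.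

#[short(type="modalRirigType")]
HB.structure Definition ModalRirig (I : Type) :=
  { A of hasModalOperators I A & Ririg A }.

Record is_filter (I : Type) (A : modalRirigType I) (F : set A) : Prop := {
  filter_nonempty : F !=set0;
  filter_up : forall x y : A, F x -> rle x y -> F y;
  filter_mul : forall x y : A, F x -> F y -> F (rmul x y);
  filter_modal : forall (m : I) (x : A), F x -> F (modal m x)
}.

Definition Fg (I : Type) (A : modalRirigType I) (X : set A) : set A :=
  smallest (@is_filter I A) X.

Definition is_least_filter (I : Type) (A : modalRirigType I) (X F : set A) :
    Prop :=
  [/\ is_filter F, X `<=` F &
      forall G : set A, is_filter G -> X `<=` G -> F `<=` G].

Definition upset (A : ririgType) (Y : set A) : set A :=
  [set z | exists2 y, Y y & rle y z].

Definition lambda (I : finType) (A : modalRirigType I) (x : A) : A :=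
  rmul x (\big[rmul/rone]_(m : I) modal m x).

Definition lambda_products (I : finType) (A : modalRirigType I) (X : set A) :
    set A :=
  [set z | exists (n : nat) (x : 'I_n -> A) (l : nat),
     (forall i, X (x i)) /\
     z = \big[rmul/rone]_(i < n) iter l (@lambda I A) (x i)].

(* Main.v *)
Require Import Defs.
From HB Require Import structures.
From mathcomp Require Import all_boot.
From mathcomp Require Import classical_sets.

(** Every filter containing [X] contains the products of iterates
    [lambda^l (x_i)], hence their up-closure, because [lambda] is built from
    the operations under which filters are closed ([lambda_products_sub]).

    Conversely the up-closure of these products is itself a filter
    ([lambda_upset_filter]), and two properties of [lambda] account for that.
    It is deflationary, since [1] is the top element; so two products formed
    with exponents [l1] and [l2] both lie above products with exponent
    [l1 + l2], and the latter can be concatenated.  And [lambda x] lies below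
    every [m x]: since modal operators are monotone and submultiplicative
    ([m x * m y <= m (x * y)]), raising the exponent by one brings the product
    below [m] of the original product. *)

Set Implicit Arguments.
Unset Strict Implicit.
Unset Printing Implicit Defensive.

Local Open Scope classical_set_scope.

(** * Order and residuation *)

Section RirigOrder.
Variable A : ririgType.
Implicit Types x y z : A.

Lemma rle_refl x : rle x x.
Proof.
(* Joins are idempotent: [x] is [x * 1], and [1 = 1 \/ 1]. *)
by rewrite /rle -{1 2 3}(rmul1l x) rmulC -rmul_joinr rjoin1l.
Qed.

Lemma rle_trans y x z : rle x y -> rle y z -> rle x z.
Proof. by rewrite /rle => xy yz; rewrite -yz rjoinA xy. Qed.

Lemma rle1 x : rle x rone.
Proof. by rewrite /rle rjoinC rjoin1l. Qed.

Lemma rone_le x : rle rone x -> x = rone.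
Proof. by rewrite /rle rjoin1l. Qed.

Lemma rle_residP x y z : rle (rmul x y) z <-> rle x (rimp y z).
Proof. exact: rmul_residuated. Qed.

Lemma rle_mul2l x y z : rle y z -> rle (rmul x y) (rmul x z).
Proof. by rewrite /rle -rmul_joinr => ->. Qed.

Lemma rle_mul x1 x2 y1 y2 :
  rle x1 y1 -> rle x2 y2 -> rle (rmul x1 x2) (rmul y1 y2).
Proof.
move=> le1 le2; apply: (@rle_trans (rmul x1 y2)); first exact: rle_mul2l.
by rewrite ![rmul _ y2]rmulC; exact: rle_mul2l.
Qed.

Lemma rmul_lel x y : rle (rmul x y) x.
Proof.
by have := rle_mul2l x (rle1 y); rewrite [rmul x rone]rmulC rmul1l.
Qed.

Lemma rle_prod (J : Type) (r : seq J) (P : pred J) (f g : J -> A) :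
  (forall j, P j -> rle (f j) (g j)) ->
  rle (\big[rmul/rone]_(j <- r | P j) f j) (\big[rmul/rone]_(j <- r | P j) g j).
Proof.
move=> le_fg; apply: (big_ind2 (@rle A)) => //; first exact: rle_refl.
by move=> *; exact: rle_mul.
Qed.

Lemma rprod_le (J : finType) (f : J -> A) (j : J) :
  rle (\big[rmul/rone]_i f i) (f j).
Proof. by rewrite (bigD1 j) //=; exact: rmul_lel. Qed.

End RirigOrder.

(** * Modal operators and lambda *)

Section Modal.
Variables (I : Type) (A : modalRirigType I).
Implicit Types (x y : A) (m : I).

(** [x <= y] means [x -> y = 1], which turns the axiom on implications into
    [1 <= m x -> m y]. *)
Lemma modal_mono m x y : rle x y -> rle (modal m x) (modal m y).
Proof.
rewrite -{1}(rmul1l x) => /rle_residP/rone_le xy1.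
have := modal_imp m x y; rewrite xy1 modal1 => /rle_residP.
by rewrite rmul1l.
Qed.

(** Apply [m] to the unit [x <= y -> x * y] of the residuation. *)
Lemma modal_submul m x y :
  rle (rmul (modal m x) (modal m y)) (modal m (rmul x y)).
Proof.
apply/rle_residP; apply: rle_trans (modal_imp m y (rmul x y)).
by apply: modal_mono; apply/rle_residP; exact: rle_refl.
Qed.

Lemma modal_subprod (J : Type) (r : seq J) (P : pred J) m (f : J -> A) :
  rle (\big[rmul/rone]_(j <- r | P j) modal m (f j))
      (modal m (\big[rmul/rone]_(j <- r | P j) f j)).
Proof.
apply: (big_ind2 (fun u v => rle u (modal m v))) => [|u u' v v' uu' vv'|j _].
- by rewrite modal1; exact: rle_refl.
- by apply: rle_trans (modal_submul m u' v'); exact: rle_mul.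
- exact: rle_refl.
Qed.

End Modal.

Section Lambda.
Variables (I : finType) (A : modalRirigType I).
Implicit Types x : A.

Lemma lambda_le x : rle (lambda x) x.
Proof. exact: rmul_lel. Qed.

Lemma lambda_le_modal m x : rle (lambda x) (modal m x).
Proof.
rewrite /lambda rmulC; apply: rle_trans (rmul_lel _ _) _.
exact: (rprod_le (fun m => modal m x)).
Qed.

Lemma iter_lambda_le n x : rle (iter n (@lambda I A) x) x.
Proof.
elim: n => [|n IHn] /=; first exact: rle_refl.
exact: rle_trans (lambda_le _) IHn.
Qed.

End Lambda.

(** * Filters *)

Section Filters.
Variables (I : Type) (A : modalRirigType I).
Implicit Types F X : set A.

Lemma filter_one F : is_filter F -> F rone.
Proof.
by move=> FF; have [x Fx] := filter_nonempty FF; exact: filter_up Fx (rle1 x).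
Qed.

Lemma filter_prod F (J : Type) (r : seq J) (P : pred J) (f : J -> A) :
  is_filter F -> (forall j, P j -> F (f j)) ->
  F (\big[rmul/rone]_(j <- r | P j) f j).
Proof.
by move=> FF Ff; apply: big_ind => //; [exact: filter_one|exact: filter_mul].
Qed.

(** Non-emptiness, the only clause that an intersection could lose, is
    witnessed by [1]. *)
Lemma Fg_filter X : is_filter (Fg X).
Proof.
split.
- by exists rone => F [FF _]; exact: filter_one.
- by move=> x y Fgx xy F FX; exact: (filter_up (proj1 FX) (Fgx F FX) xy).
- move=> x y Fgx Fgy F FX.
  exact: (filter_mul (proj1 FX) (Fgx F FX) (Fgy F FX)).
- by move=> m x Fgx F FX; exact: (filter_modal (proj1 FX) m (Fgx F FX)).
Qed.

Lemma Fg_least X : is_least_filter X (Fg X).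
Proof.
split; first exact: Fg_filter.
- by move=> x Xx F [_]; exact.
- by move=> F FF XF x; apply.
Qed.

End Filters.

Section Generation.
Variables (I : finType) (A : modalRirigType I).
Implicit Types F X : set A.

Lemma filter_iter_lambda F n (x : A) :
  is_filter F -> F x -> F (iter n (@lambda I A) x).
Proof.
move=> FF Fx; elim: n => //= n IHn; apply: (filter_mul FF) => //.
by apply: filter_prod => // m _; exact: filter_modal.
Qed.

Lemma lambda_products_sub F X :
  is_filter F -> X `<=` F -> upset (lambda_products X) `<=` F.
Proof.
move=> FF XF z [_ [n [x [l [Xx ->]]]] le_z]; apply: (filter_up FF) le_z.
by apply: filter_prod => // i _; apply: filter_iter_lambda => //; exact: XF.
Qed.

Lemma sub_lambda_upset X : X `<=` upset (lambda_products X).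
Proof.
move=> x Xx; exists x; last exact: rle_refl.
by exists 1, (fun=> x), 0; split=> //; rewrite big_ord1.
Qed.

Lemma lambda_upset_filter X : is_filter (upset (lambda_products X)).
Proof.
split.
- exists rone; exists rone; last exact: rle_refl.
  (* The empty product is available even if [X] is empty; its
     family of factors has an empty domain, so its value [rone] is a dummy. *)
  exists 0, (fun=> rone), 0; split; first by case.
  by rewrite big_ord0.
- by move=> x y [u Xu ux] xy; exists u => //; exact: rle_trans ux xy.
- move=> y1 y2 [_ [n1 [x1 [l1 [Xx1 ->]]]] le1] [_ [n2 [x2 [l2 [Xx2 ->]]]] le2].
  pose x (i : 'I_(n1 + n2)) :=
    match split i with inl i1 => x1 i1 | inr i2 => x2 i2 end.
  exists (\big[rmul/rone]_i iter (l1 + l2) (@lambda I A) (x i)).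
    by exists (n1 + n2)%N, x, (l1 + l2)%N; split=> // i; rewrite /x; case: split.
  rewrite big_split_ord; apply: rle_mul.
  + apply: rle_trans le1; apply: rle_prod => i _.
    rewrite /x (unsplitK (inl i)) addnC iterD.
    exact: iter_lambda_le.
  + apply: rle_trans le2; apply: rle_prod => i _.
    rewrite /x (unsplitK (inr i)) iterD.
    exact: iter_lambda_le.
- move=> m y [_ [n [x [l [Xx ->]]]] le_y].
  exists (\big[rmul/rone]_i iter l.+1 (@lambda I A) (x i)).
    by exists n, x, l.+1.
  apply: rle_trans (modal_mono m le_y); apply: rle_trans (modal_subprod _ _ _ _).
  by apply: rle_prod => i _; exact: lambda_le_modal.
Qed.

End Generation.

Theorem lemma3p10 (I : finType) (A : modalRirigType I) (X : set A) :
  is_least_filter X (Fg X) /\ Fg X = upset (lambda_products X).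
Proof.
have [FgF XFg Fg_min] := Fg_least X; split; first by split.
apply/seteqP; split; last exact: lambda_products_sub.
by apply: Fg_min; [exact: lambda_upset_filter|exact: sub_lambda_upset].
Qed.
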